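(* Let $G$ be a graph with $\operatorname{diam}(G)=2$ and order $n(G)$. Then $$\gamma_g(G)\le \left\lceil \frac{n(G)}{2}\right\rceil-\left\lfloor \frac{n(G)}{11}\right\rfloor .$$
   Context: Graphs are finite, simple and undirected; $n(G)$ is the number of vertices. A vertex dominates itself and its neighbors. The domination game on a graph $G$ is played by Dominator and Staller, who alternately select vertices of $G$; each selected vertex must dominate at least one vertex not dominated by the previously selected vertices. The game ends when the selected vertices form a dominating set of $G$. Dominator aims to finish the game in as few moves as possible, Staller aims for the opposite. In the D-game Dominator makes the first move. The game domination number $\gamma_g(G)$ is the total number of vertices selected in the D-game when both players play optimally. *)

(* Defs.v *)
From mathcomp Require Import all_boot.

Set Implicit Arguments.
Unset Strict Implicit.
Unset Printing Implicit Defensive.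

(* A simple graph is a symmetric irreflexive relation e on a finType T.       *)

Section Distance.
Variables (T : finType) (e : rel T).

Definition walk_of_length (k : nat) (x y : T) : bool :=
  [exists p : k.-tuple T, path e x p && (last x p == y)].

(* The default value #|T| is returned exactly when x and y are disconnected,  *)
(* since a shortest walk has fewer than #|T| edges; diam never uses it.       *)
Definition dist (x y : T) : nat :=
  find (fun k => walk_of_length k x y) (iota 0 #|T|).

(* None stands for the infinite diameter of a disconnected graph.             *)
Definition diam : option nat :=
  if [forall x, forall y, connect e x y]
  then Some (\max_(x : T) \max_(y : T) dist x y) else None.

End Distance.

Section DominationGame.
Variables (T : finType) (e : rel T).

Definition closed_nbhd (v : T) : {set T} := [set u | (u == v) || e v u].

Definition dominated (S : {set T}) : {set T} :=
  \bigcup_(v in S) closed_nbhd v.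

Definition dominating (S : {set T}) : bool := dominated S == setT.

Definition legal (S : {set T}) (v : T) : bool :=
  ~~ (closed_nbhd v \subset dominated S).

Inductive player := Dominator | Staller.

Definition opponent (p : player) : player :=
  if p is Dominator then Staller else Dominator.

(* Minimax number of further moves when S has been selected and p is to move; *)
(* k bounds the number of moves explored.                                     *)
Fixpoint moves_left_upto (k : nat) (p : player) (S : {set T}) : nat :=
  if k is k'.+1 then
    if dominating S then 0
    else let after v := moves_left_upto k' (opponent p) (v |: S) in
      (if p is Dominator then \big[minn/#|T|]_(v | legal S v) after v
       else \max_(v | legal S v) after v).+1
  else 0.

(* Every move dominates a new vertex, so no game exceeds #|T| moves; hence    *)
(* neither the bound k nor the default value of minn affects the result, see  *)
(* moves_left_dominating, moves_left_Dominator and moves_left_Staller.        *)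
Definition moves_left (p : player) (S : {set T}) : nat :=
  moves_left_upto #|T| p S.

Definition game_domination_number : nat := moves_left Dominator set0.

Lemma bigminn_le d (P : pred T) (F : T -> nat) v :
  P v -> \big[minn/d]_(i | P i) F i <= F v.
Proof.
move=> Pv; elim: (index_enum T) (mem_index_enum v) => // x r IH.
rewrite inE big_cons => /predU1P[<-|/IH le_r]; first by rewrite Pv geq_minl.
by case: ifP => // _; apply: leq_trans (geq_minr _ _) le_r.
Qed.

Lemma dominatedU1 v S : dominated (v |: S) = closed_nbhd v :|: dominated S.
Proof. by rewrite /dominated bigcup_setU big_set1. Qed.

Lemma legal_decr S v : legal S v ->
  #|~: dominated (v |: S)| < #|~: dominated S|.
Proof.
move=> lv; apply: proper_card.
rewrite properE !setCS dominatedU1 subsetUr /= subUset negb_and.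
by rewrite -/(legal S v) lv.
Qed.

Lemma dominatingE S : dominating S = (#|~: dominated S| == 0).
Proof. by rewrite cards_eq0 -setCT (inj_eq (@setC_inj T)). Qed.

Lemma exists_legal S : ~~ dominating S -> exists v, legal S v.
Proof.
rewrite /dominating -subTset => /subsetPn[v _ vS]; exists v; apply/subsetPn.
by exists v => //; rewrite inE eqxx.
Qed.

Lemma moves_left_upto_stable k p S : #|~: dominated S| <= k ->
  moves_left_upto k p S = moves_left_upto #|~: dominated S| p S.
Proof.
elim/ltn_ind: k p S => -[|k] IH p S; first by rewrite leqn0 => /eqP->.
move=> le_k; have [dS|] := boolP (dominating S).
  by move: (dS); rewrite dominatingE => /eqP->; rewrite /= dS.
case E: #|~: dominated S| => [|m]; first by rewrite dominatingE E.
move=> ndS; rewrite /= (negPf ndS).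
have eq_after v : legal S v -> moves_left_upto k (opponent p) (v |: S) =
                               moves_left_upto m (opponent p) (v |: S).
  move/legal_decr; rewrite E ltnS => le_m.
  have lt_mk : m <= k by rewrite -ltnS -E.
  rewrite (IH k) ?(leq_trans le_m) //.
  by rewrite (IH m) // -E.
by congr _.+1; case: p eq_after => eq_after; apply: eq_bigr => v /eq_after.
Qed.

Lemma moves_left_upto_le k p S :
  moves_left_upto k p S <= #|~: dominated S|.
Proof.
elim: k p S => [|k IH] p S //=; case: ifPn => // /exists_legal[v0 l0].
have le_after v : legal S v ->
    moves_left_upto k (opponent p) (v |: S) < #|~: dominated S|.
  by move=> lv; apply: leq_ltn_trans (IH _ _) (legal_decr lv).
case: p le_after => le_after.
  exact: leq_ltn_trans (bigminn_le _ _ l0) (le_after v0 l0).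
case E: #|~: dominated S| => [|m]; first by have := legal_decr l0; rewrite E.
by rewrite ltnS; apply/bigmax_leqP => v /le_after; rewrite E ltnS.
Qed.

Lemma moves_left_dominating p S : dominating S -> moves_left p S = 0.
Proof. by rewrite /moves_left; case: #|T| => //= n ->. Qed.

Lemma moves_leftE p S : ~~ dominating S ->
  moves_left p S =
  (if p is Dominator
   then \big[minn/#|T|]_(v | legal S v) moves_left (opponent p) (v |: S)
   else \max_(v | legal S v) moves_left (opponent p) (v |: S)).+1.
Proof.
move=> ndS; have le_T := max_card (mem (~: dominated S)).
have -> : moves_left p S = moves_left_upto #|T|.+1 p S.
  rewrite [RHS]moves_left_upto_stable ?(leqW le_T) //.
  by rewrite /moves_left moves_left_upto_stable.
by rewrite /= (negPf ndS).
Qed.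

Lemma moves_left_Dominator S : ~~ dominating S ->
  (exists2 v, legal S v &
     moves_left Dominator S = (moves_left Staller (v |: S)).+1) /\
  (forall v, legal S v ->
     moves_left Dominator S <= (moves_left Staller (v |: S)).+1).
Proof.
move=> ndS; have [v0 l0] := exists_legal ndS.
rewrite (moves_leftE _ ndS) /=; set m := \big[_/_]_(v | _) _.
have le_m v : legal S v -> m <= moves_left Staller (v |: S).
  by move=> lv; apply: bigminn_le.
split=> [|v lv]; last by rewrite ltnS le_m.
case: (arg_minnP (fun v => moves_left Staller (v |: S)) l0) => v lv min_v.
exists v => //; congr _.+1; apply/eqP; rewrite eqn_leq le_m //=.
rewrite /m; elim/big_ind: _ => // [|x y le_x le_y]; last by rewrite leq_min le_x.
exact: leq_trans (moves_left_upto_le _ _ _) (max_card _).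
Qed.

Lemma moves_left_Staller S : ~~ dominating S ->
  (exists2 v, legal S v &
     moves_left Staller S = (moves_left Dominator (v |: S)).+1) /\
  (forall v, legal S v ->
     (moves_left Dominator (v |: S)).+1 <= moves_left Staller S).
Proof.
move=> ndS; have [v0 l0] := exists_legal ndS.
rewrite (moves_leftE _ ndS) /=; split=> [|v lv]; last first.
  exact: (@leq_bigmax_cond _ (legal S) (fun v => moves_left _ (v |: S))).
have [|v lv ->] := @eq_bigmax_cond _ (legal S)
  (fun v => moves_left Dominator (v |: S)); last by exists v.
by apply/card_gt0P; exists v0.
Qed.

End DominationGame.

(* Main.v *)
Require Import Defs.
From mathcomp Require Import all_boot.
From mathcomp Require Import zify.

Set Implicit Arguments.
Unset Strict Implicit.
Unset Printing Implicit Defensive.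

(** Put [f = uphalf n - n %/ 11].  Dominator has two strategies, and one of
    them always finishes within [f] moves.

    If some vertex [v] has degree [d] with [2 * d - 1 <= f], its open
    neighborhood dominates the graph because the diameter is 2.  By always
    playing a legal vertex of a dominating set [A], Dominator ends the game
    within [2 * #|A| - 1] moves ([moves_left_dominating_set]).

    Otherwise every closed neighborhood has at least [c = uphalf f + 2]
    vertices, which is more than [n / 5], and Dominator plays greedily.  When
    [m] vertices have been selected and [u] vertices are undominated, counting
    the pairs (vertex, undominated vertex in its closed neighborhood) yields a
    vertex dominating at least [u * c / (n - m)] new vertices, since the
    selected vertices no longer contribute ([greedy_vertex]).  Staller's reply
    dominates at least one more.  The resulting recursive bound [greedy_bound]
    on the length of the game is evaluated for every [n < 88]; for larger [n]
    it suffices that each of the first eight rounds leaves at most 4/5 of the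
    undominated vertices, and that every later move dominates a new vertex
    ([greedy_bound_le]). *)

(** * Strategies for Dominator *)

Section Game.
Variables (T : finType) (e : rel T).
Implicit Types (S A : {set T}) (v : T).

Lemma legal_notin S v : legal e S v -> v \notin S.
Proof.
move=> /subsetPn[x xv xS]; apply/negP => vS; case/negP: xS.
by apply/bigcupP; exists v.
Qed.

Lemma legal_subset S S' v : S \subset S' -> legal e S' v -> legal e S v.
Proof.
move=> sSS'; apply: contra => /subset_trans; apply.
by apply/bigcupsP => x xS; apply: (bigcup_max x) => //; apply: subsetP xS.
Qed.

Lemma not_legal_setU1 S v : ~~ legal e (v |: S) v.
Proof. by rewrite negbK dominatedU1 subsetUl. Qed.

(** Only the legal vertices of [A] matter: every move of Dominator in [A]
    removes one of them, and no move creates a new one. *)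
Lemma moves_left_legal_dominating_set A S :
  dominating e A ->
  moves_left e Dominator S <= (#|[set a in A | legal e S a]|.*2).-1.
Proof.
move=> /eqP domA.
have ex_legal S' : ~~ dominating e S' -> exists2 a, a \in A & legal e S' a.
  rewrite /dominating -subTset => /subsetPn[x _ xS'].
  have: x \in dominated e A by rewrite domA.
  by case/bigcupP => a aA xa; exists a => //; apply/subsetPn; exists x.
have card_lt a S' : a \in A -> legal e S' a ->
  #|[set b in A | legal e (a |: S') b]| < #|[set b in A | legal e S' b]|.
  move=> aA la; apply: proper_card; apply/properP; split.
    apply/subsetP => b; rewrite !inE => /andP[-> /=].
    exact/legal_subset/subsetUr.
  by exists a; rewrite !inE aA ?la // (negPf (not_legal_setU1 _ _)).
have [k le_k] := ubnP #|[set a in A | legal e S a]|.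
elim: k S le_k => // k IH S le_k.
have [dS|ndS] := boolP (dominating e S); first by rewrite moves_left_dominating.
have [a aA la] := ex_legal S ndS.
have lt_a := card_lt a S aA la.
have := (moves_left_Dominator ndS).2 a la.
have [dS'|ndS'] := boolP (dominating e (a |: S)).
  by rewrite (moves_left_dominating _ dS'); lia.
have [[w lw ->] _] := moves_left_Staller ndS'.
have le_w : #|[set b in A | legal e (w |: (a |: S)) b]| <=
            #|[set b in A | legal e (a |: S) b]|.
  apply: subset_leq_card; apply/subsetP => b; rewrite !inE => /andP[-> /=].
  exact/legal_subset/subsetUr.
have gt0 : 0 < #|[set b in A | legal e (a |: S) b]|.
  have [b bA lb] := ex_legal _ ndS'.
  by apply/card_gt0P; exists b; rewrite inE bA.
have lt_k : #|[set b in A | legal e (w |: (a |: S)) b]| < k by lia.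
by have := IH _ lt_k; lia.
Qed.

Lemma moves_left_dominating_set A :
  dominating e A -> game_domination_number e <= (#|A|.*2).-1.
Proof.
move=> domA; apply: leq_trans (moves_left_legal_dominating_set set0 domA) _.
have := subset_leq_card (subsetIl A [set a | legal e set0 a]).
by rewrite -setIdE; lia.
Qed.

Hypothesis e_sym : symmetric e.

Lemma closed_nbhd_sym x y : (x \in closed_nbhd e y) = (y \in closed_nbhd e x).
Proof. by rewrite !inE eq_sym e_sym. Qed.

(** The number of vertices that become dominated when [v] is selected. *)
Definition gain S v := #|closed_nbhd e v :&: ~: dominated e S|.

Lemma card_undominatedU1 S v :
  #|~: dominated e (v |: S)| = #|~: dominated e S| - gain S v.
Proof.
by rewrite dominatedU1 setCU setIC -setDE cardsD /gain setIC.
Qed.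

Lemma legal_gain S v : legal e S v = (0 < gain S v).
Proof.
rewrite card_gt0 /legal -setD_eq0; congr (~~ (_ == _)).
by rewrite setDE.
Qed.

Lemma gain_selected S v : v \in S -> gain S v = 0.
Proof.
by move=> vS; apply/eqP; rewrite -leqn0 leqNgt -legal_gain;
   apply: contraL vS => /legal_notin.
Qed.

Lemma sum_gain S :
  \sum_v gain S v = \sum_(u in ~: dominated e S) #|closed_nbhd e u|.
Proof.
transitivity (\sum_v \sum_(u in ~: dominated e S) (u \in closed_nbhd e v : nat)).
  apply: eq_bigr => v _; rewrite -big_mkcondr /= sum1dep_card /gain.
  by apply: eq_card => u; rewrite !inE andbC.
rewrite exchange_big; apply: eq_bigr => u _.
rewrite -big_mkcond sum1dep_card; apply: eq_card => v.
by rewrite inE closed_nbhd_sym.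
Qed.

Variable c : nat.
Hypothesis c_le : forall v, c <= #|closed_nbhd e v|.

(** Some vertex gains at least the average over the unselected vertices;
    selected vertices gain nothing. *)
Lemma greedy_vertex S : ~~ dominating e S ->
  exists2 v, legal e S v & #|~: dominated e S| * c <= gain S v * (#|T| - #|S|).
Proof.
move=> ndS; have [v0 lv0] := exists_legal ndS.
case: (arg_maxnP (gain S) lv0) => v lv max_v; exists v => //.
have <- : #|~: S| = #|T| - #|S| by rewrite cardsCs setCK.
rewrite -sum_nat_const; apply: leq_trans (_ : \sum_x gain S x <= _).
  by rewrite sum_gain; apply: leq_sum.
rewrite mulnC -sum_nat_const big_mkcond [leqRHS]big_mkcond /=.
apply: leq_sum => x _; rewrite inE.
case: ifPn => [_|/negbNE/gain_selected -> //].
have [lx|] := boolP (legal e S x); first exact: max_v.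
by rewrite legal_gain -leqNgt leqn0 => /eqP->.
Qed.

End Game.

(** * The length of a greedy game *)

(** An upper bound on the number of moves still to come in a graph of order
    [n] with closed neighborhoods of size at least [c], when Dominator is to
    move, [m] vertices are selected, at most [b] are undominated, and Dominator
    plays greedily: [b'] bounds what is left after Dominator's move, and Staller
    then dominates at least one more vertex.  After [k] rounds it falls back on
    the trivial bound of one move per undominated vertex. *)
Fixpoint greedy_bound (n c k m b : nat) : nat :=
  if k is k'.+1 then
    if b == 0 then 0
    else let b' := (b * (n - m - c)) %/ (n - m) in
      if b' == 0 then 1 else (greedy_bound n c k' m.+2 b'.-1).+2
  else b.

Lemma moves_left_greedy (T : finType) (e : rel T) (c k b : nat)
    (S : {set T}) :
  symmetric e -> (forall v, c <= #|closed_nbhd e v|) ->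
  #|~: dominated e S| <= b ->
  moves_left e Dominator S <= greedy_bound #|T| c k #|S| b.
Proof.
move=> e_sym c_le; elim: k S b => [|k IH] S b le_b.
  by apply: leq_trans le_b; apply: moves_left_upto_le.
have [dS|ndS] := boolP (dominating e S); first by rewrite moves_left_dominating.
have u_gt0 : 0 < #|~: dominated e S| by rewrite lt0n -dominatingE.
rewrite /=; case: eqP => [b0|_]; first by move: le_b; rewrite b0 leqNgt u_gt0.
set b' := _ %/ _.
have [v lv gain_v] := greedy_vertex e_sym c_le ndS.
have card_v : #|v |: S| = #|S|.+1 by rewrite cardsU1 (legal_notin lv).
have le_b' : #|~: dominated e (v |: S)| <= b'.
  have n_gt : 0 < #|T| - #|S| by rewrite subn_gt0 -card_v max_card.
  rewrite leq_divRL // card_undominatedU1.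
  apply: leq_trans (_ : #|~: dominated e S| * (#|T| - #|S| - c) <= _).
    by rewrite mulnBl [leqRHS]mulnBr leq_sub2l.
  by rewrite leq_mul2r le_b orbT.
apply: leq_trans ((moves_left_Dominator ndS).2 v lv) _.
have [dS'|ndS'] := boolP (dominating e (v |: S)).
  by rewrite (moves_left_dominating _ dS'); case: ifP.
have u'_gt0 : 0 < #|~: dominated e (v |: S)| by rewrite lt0n -dominatingE.
case: eqP => [b'0|_]; first by move: le_b'; rewrite b'0 leqNgt u'_gt0.
have [[w lw ->] _] := moves_left_Staller ndS'.
have <- : #|w |: (v |: S)| = #|S|.+2.
  by rewrite cardsU1 (legal_notin lw) card_v.
by rewrite !ltnS; apply: IH; have := legal_decr lw; lia.
Qed.

(** As [c >= n / 5], each greedy move leaves at most 4/5 of the undominated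
    vertices, whatever the number of selected ones. *)
Lemma greedy_bound_le (n c k m b : nat) : n <= 5 * c ->
  5 ^ k * greedy_bound n c k m b <= 5 ^ k * k.*2 + 4 ^ k * b.
Proof.
move=> le_n; elim: k m b => [|k IH] m b; first by rewrite /= !mul1n.
rewrite /=; case: eqP => [->|_]; first by rewrite muln0.
set b' := _ %/ _.
have le_b' : 5 * b' <= 4 * b.
  have [nm0|nm_gt0] := posnP (n - m); first by rewrite /b' nm0 divn0 muln0.
  rewrite -(leq_pmul2r nm_gt0) -mulnA.
  have h : b' * (n - m) <= b * (n - m - c) by apply: leq_divM.
  apply: leq_trans (leq_mul (leqnn 5) h) _.
  by rewrite mulnCA mulnAC mulnC leq_mul2r; apply/orP; right; lia.
have p5 : 0 < 5 ^ k by rewrite expn_gt0.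
rewrite !expnS; case: eqP => [_|_]; first by nia.
have := IH m.+2 b'.-1; nia.
Qed.

Lemma greedy_bound_small (n : nat) : n < 88 ->
  let f := uphalf n - n %/ 11 in
  greedy_bound n (uphalf f + 2) 8 0 n <= f.
Proof.
move=> lt_n /=.
have: all (fun n => let f := uphalf n - n %/ 11 in
    greedy_bound n (uphalf f + 2) 8 0 n <= f) (iota 0 88) by vm_compute.
by move/allP/(_ n); rewrite mem_iota => /(_ lt_n).
Qed.

Lemma greedy_bound_order (n : nat) :
  let f := uphalf n - n %/ 11 in
  greedy_bound n (uphalf f + 2) 8 0 n <= f.
Proof.
have [/greedy_bound_small//|le_n] := ltnP n 88; cbv zeta.
set f := uphalf n - _; have le_f : 9 * n <= 22 * f by lia.
have le_5c : n <= 5 * (uphalf f + 2) by lia.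
(* By [greedy_bound_le] at most 16 + (4/5)^8 n moves are needed, which is below
   9 n / 22 from [n = 67] on. *)
by have := greedy_bound_le 8 0 n le_5c; rewrite !expnS !expn0; lia.
Qed.

(** * Graphs of diameter 2 *)

Section Diameter.
Variables (T : finType) (e : rel T).
Hypothesis diam2 : diam e = Some 2.

Lemma diam2_walk x y : x != y -> e x y \/ exists2 z, e x z & e z y.
Proof.
move=> neq_xy; move: diam2; rewrite /diam; case: ifP => // conn [max2].
have le2 : dist e x y <= 2.
  rewrite -max2; apply: leq_trans (leq_bigmax x).
  exact: (leq_bigmax (F := fun y => dist e x y)).
have has_walk : has (fun k => walk_of_length e k x y) (iota 0 #|T|).
  have /connectP[p ep ->] : connect e x y.
    by move/forallP: conn => /(_ x)/forallP.
  case/shortenP: ep => q eq uq _; apply/hasP; exists (size q).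
    rewrite mem_iota add0n; have := max_card (mem (x :: q)).
    by rewrite (card_uniqP uq).
  by apply/existsP; exists (in_tuple q); rewrite eq eqxx.
have := nth_find 0 has_walk; rewrite -/(dist e x y).
have := has_walk; rewrite has_find size_iota -/(dist e x y) => lt_T.
rewrite nth_iota // add0n => /existsP[[p /= /eqP szp]] /andP[].
case: p szp => [|a [|b [|? ?]]] /=.
- by move=> _ _; rewrite (negPf neq_xy).
- by move=> _ /andP[xa _] /eqP<-; left.
- by move=> _ /and3P[xa ab _] /eqP<-; right; exists a.
- by move=> szp; move: le2; rewrite -szp.
Qed.

Lemma diam2_neighbor x : exists y, e x y.
Proof.
have [y neq_xy|all_x] := pickP (fun y => x != y).
  by case: (diam2_walk neq_xy) => [|[z]]; [exists y | exists z].
(* Otherwise [x] is the only vertex, and all distances are at most 1. *)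
move: diam2; rewrite /diam; case: ifP => // _ [max2].
have: 2 <= 1; last by [].
rewrite -{1}max2; apply/bigmax_leqP => a _; apply/bigmax_leqP => b _.
rewrite /dist; apply: leq_trans (find_size _ _) _; rewrite size_iota.
rewrite -(card1 x); apply/subset_leq_card/subsetP => z _.
by rewrite inE eq_sym; apply/negbFE/all_x.
Qed.

Lemma diam2_nbhd_dominating v : symmetric e -> dominating e [set u | e v u].
Proof.
move=> e_sym; apply/eqP/setP => x; rewrite inE; apply/bigcupP.
have [<-|neq_vx] := eqVneq v x.
  have [y vy] := diam2_neighbor v.
  by exists y; rewrite ?inE ?vy // e_sym vy orbT.
have [vx|[z vz zx]] := diam2_walk neq_vx.
  by exists x; rewrite inE ?vx ?eqxx.
by exists z; rewrite inE ?vz ?zx ?orbT.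
Qed.

End Diameter.

Theorem theorem4p1 (T : finType) (e : rel T)
  (e_sym : symmetric e) (e_irr : irreflexive e) (diam2 : diam e = Some 2) :
  game_domination_number e <= uphalf #|T| - #|T| %/ 11.
Proof.
set f := uphalf _ - _.
have [v le_v|gt_f] := pickP (fun v => (#|[set u | e v u]|.*2).-1 <= f).
  apply: leq_trans le_v; apply: moves_left_dominating_set.
  exact: diam2_nbhd_dominating.
have c_le v : uphalf f + 2 <= #|closed_nbhd e v|.
  have -> : closed_nbhd e v = v |: [set u | e v u].
    by apply/setP => u; rewrite !inE.
  rewrite cardsU1 inE e_irr; have := gt_f v; lia.
have le_T : #|~: dominated e set0| <= #|T| by apply: max_card.
apply: leq_trans (moves_left_greedy 8 e_sym c_le le_T) _.
by rewrite cards0; apply: greedy_bound_order.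
Qed.
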